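(* Let $\mathcal{D}$ be a cartesian monoidal category and let $T$ be a commutative monad on $\mathcal{D}$, with lax monoidal structure maps $c_{X,Y}\colon TX\times TY\to T(X\times Y)$. Then the following conditions are equivalent: 1. $T$ is weakly affine; 2. the Kleisli category $\mathrm{Kl}_T$ is weakly Markov; 3. for all objects $X$, $Y$ and $Z$ of $\mathcal{D}$, the (commutative) associativity square $$\begin{array}{ccc} T(X)\times T(Y)\times T(Z) & \xrightarrow{\ \mathrm{id}\times c_{Y,Z}\ } & T(X)\times T(Y\times Z)\\ {\scriptstyle c_{X,Y}\times \mathrm{id}}\downarrow & & \downarrow{\scriptstyle c_{X,Y\times Z}}\\ T(X\times Y)\times T(Z) & \xrightarrow{\ c_{X\times Y,Z}\ } & T(X\times Y\times Z)\end{array}$$ is a pullback in $\mathcal{D}$.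
   Context: A cartesian monoidal category is a category with finite products, regarded as a symmetric monoidal category with tensor $\times$ and unit the terminal object $1$; write $\mathrm{copy}_X\colon X\to X\times X$ for the diagonal and $\mathrm{del}_X\colon X\to 1$ for the unique map. Associativity and unit isomorphisms are suppressed, so e.g. $(X\times Y)\times Z$ and $X\times(Y\times Z)$ are identified. A commutative monad $(T,\eta,\mu)$ on $\mathcal{D}$ is a strong monad whose left and right strengths commute; equivalently, a lax symmetric monoidal monad, with structure maps $c_{X,Y}\colon TX\times TY\to T(X\times Y)$ and unit map $\eta_1\colon 1\to T1$. A gs-monoidal category is a symmetric monoidal category $(\mathcal{C},\otimes,I)$ in which every object $X$ carries a commutative comonoid structure $\mathrm{copy}_X\colon X\to X\otimes X$, $\mathrm{del}_X\colon X\to I$, multiplicative with respect to the monoidal structure: $\mathrm{copy}_{X\otimes Y}$ equals $\mathrm{copy}_X\otimes\mathrm{copy}_Y$ followed by the swap of the two middle factors, $\mathrm{del}_{X\otimes Y}=\mathrm{del}_X\otimes\mathrm{del}_Y$, and the comonoid structure on $I$ is the trivial one (up to coherence isomorphisms). Naturality of $\mathrm{copy}$ and $\mathrm{del}$ is not required. For every object $X$ of a gs-monoidal category $\mathcal{C}$, the set $\mathcal{C}(X,I)$ is a commutative monoid with unit $\mathrm{del}_X$ and product $ab:=(a\otimes b)\circ\mathrm{copy}_X$ (using $I\otimes I\cong I$). The category $\mathcal{C}$ is called weakly Markov if for every object $X$ the monoid $\mathcal{C}(X,I)$ is a group. The Kleisli category $\mathrm{Kl}_T$ is gs-monoidal as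 follows. Its objects are those of $\mathcal{D}$; a morphism $f\colon X\to Y$ is represented by a morphism $f^\sharp\colon X\to TY$ of $\mathcal{D}$; the tensor is $\times$ on objects, and $f\otimes g$ is represented by $c\circ(f^\sharp\times g^\sharp)$; the unit object is $1$; the copy and discard morphisms are represented by $\eta\circ\mathrm{copy}_X$ and $\eta\circ\mathrm{del}_X$. The object $T1$ is canonically an internal commutative monoid in $\mathcal{D}$ with unit $\eta_1\colon 1\to T1$ and multiplication $T1\times T1\xrightarrow{c_{1,1}}T(1\times 1)\cong T1$. The monad $T$ is called weakly affine if $T1$ with this monoid structure is an internal group. *)

(* Defs.v *)
From Corelib Require Import ssreflect.

Set Implicit Arguments.
Unset Strict Implicit.
Unset Printing Implicit Defensive.

Declare Scope cat_scope.
Delimit Scope cat_scope with cat.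
Local Open Scope cat_scope.

Record category : Type := Category {
  ob :> Type;
  hom : ob -> ob -> Type;
  idm : forall X, hom X X;
  mcomp : forall X Y Z, hom Y Z -> hom X Y -> hom X Z;
  compA : forall W X Y Z (h : hom Y Z) (g : hom X Y) (f : hom W X),
    mcomp h (mcomp g f) = mcomp (mcomp h g) f;
  comp1m : forall X Y (f : hom X Y), mcomp (idm Y) f = f;
  compm1 : forall X Y (f : hom X Y), mcomp f (idm X) = f
}.

Arguments hom {c} X Y.
Arguments idm {c} X.
Arguments mcomp {c X Y Z} g f : rename.
Arguments compA {c W X Y Z} h g f.
Arguments comp1m {c X Y} f.
Arguments compm1 {c X Y} f.

Notation "g '\oc' f" := (mcomp g f)
  (at level 40, left associativity, format "g  '\oc'  f") : cat_scope.

Definition is_pullback (C : category) (P A B D : C)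
    (p : hom P A) (q : hom P B) (f : hom A D) (g : hom B D) : Prop :=
  f \oc p = g \oc q /\
  forall (W : C) (a : hom W A) (b : hom W B), f \oc a = g \oc b ->
    exists! u : hom W P, p \oc u = a /\ q \oc u = b.

Section Reassoc.
Variable C : category.

Lemma pre2 (X Y Z : C) (g : hom Y Z) (f : hom X Y) (h : hom X Z) :
  g \oc f = h -> forall W (k : hom W X), g \oc (f \oc k) = h \oc k.
Proof. by move=> e W k; rewrite compA e. Qed.

Lemma pre3 (X1 X2 X3 X4 : C) (a : hom X3 X4) (b : hom X2 X3) (c : hom X1 X2)
    (h : hom X1 X4) :
  a \oc (b \oc c) = h ->
  forall W (k : hom W X1), a \oc (b \oc (c \oc k)) = h \oc k.
Proof. by move=> <- W k; rewrite !compA. Qed.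

Lemma cancel_epi (X Y Z : C) (e : hom X Y) (e' : hom Y X) (f g : hom Y Z) :
  e \oc e' = idm Y -> f \oc e = g \oc e -> f = g.
Proof. by move=> ee' E; rewrite -(compm1 f) -(compm1 g) -ee' !compA E. Qed.

Lemma cancel_mono (X Y Z : C) (m : hom Y Z) (m' : hom Z Y) (f g : hom X Y) :
  m' \oc m = idm Y -> m \oc f = m \oc g -> f = g.
Proof. by move=> mm' E; rewrite -(comp1m f) -(comp1m g) -mm' -!compA E. Qed.

End Reassoc.

Record comMonoid : Type := ComMonoid {
  cm_car :> Type;
  cm_one : cm_car;
  cm_mul : cm_car -> cm_car -> cm_car;
  cm_mulA : forall a b c, cm_mul a (cm_mul b c) = cm_mul (cm_mul a b) c;
  cm_mulC : forall a b, cm_mul a b = cm_mul b a;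
  cm_mul1 : forall a, cm_mul cm_one a = a
}.

Definition is_group (M : comMonoid) : Prop :=
  forall a : M, exists b : M,
    cm_mul a b = cm_one M /\ cm_mul b a = cm_one M.

Record symMonoidal : Type := SymMonoidal {
  smcat :> category;
  munit : smcat;
  tens : smcat -> smcat -> smcat;
  tensm : forall X Y X' Y' : smcat,
    hom X X' -> hom Y Y' -> hom (tens X Y) (tens X' Y');
  assoc : forall X Y Z, hom (tens (tens X Y) Z) (tens X (tens Y Z));
  associ : forall X Y Z, hom (tens X (tens Y Z)) (tens (tens X Y) Z);
  lunit : forall X, hom (tens munit X) X;
  luniti : forall X, hom X (tens munit X);
  runit : forall X, hom (tens X munit) X;
  runiti : forall X, hom X (tens X munit);
  swap : forall X Y, hom (tens X Y) (tens Y X);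
  tensm1 : forall X Y, tensm (idm X) (idm Y) = idm (tens X Y);
  tensmM : forall X Y X' Y' X'' Y'' (f' : hom X' X'') (g' : hom Y' Y'')
      (f : hom X X') (g : hom Y Y'),
    tensm (f' \oc f) (g' \oc g) = tensm f' g' \oc tensm f g;
  assocK : forall X Y Z, associ X Y Z \oc assoc X Y Z = idm _;
  associK : forall X Y Z, assoc X Y Z \oc associ X Y Z = idm _;
  lunitK : forall X, luniti X \oc lunit X = idm _;
  lunitiK : forall X, lunit X \oc luniti X = idm _;
  runitK : forall X, runiti X \oc runit X = idm _;
  runitiK : forall X, runit X \oc runiti X = idm _;
  swapK : forall X Y, swap Y X \oc swap X Y = idm _;
  assoc_nat : forall X Y Z X' Y' Z'
      (f : hom X X') (g : hom Y Y') (h : hom Z Z'),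
    assoc X' Y' Z' \oc tensm (tensm f g) h
    = tensm f (tensm g h) \oc assoc X Y Z;
  lunit_nat : forall X Y (f : hom X Y),
    lunit Y \oc tensm (idm munit) f = f \oc lunit X;
  runit_nat : forall X Y (f : hom X Y),
    runit Y \oc tensm f (idm munit) = f \oc runit X;
  swap_nat : forall X Y X' Y' (f : hom X X') (g : hom Y Y'),
    swap X' Y' \oc tensm f g = tensm g f \oc swap X Y;
  pentagon : forall W X Y Z,
    tensm (idm W) (assoc X Y Z) \oc
      (assoc W (tens X Y) Z \oc tensm (assoc W X Y) (idm Z))
    = assoc W X (tens Y Z) \oc assoc (tens W X) Y Z;
  triangle : forall X Y,
    tensm (idm X) (lunit Y) \oc assoc X munit Y = tensm (runit X) (idm Y);
  hexagon : forall X Y Z,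
    assoc Y Z X \oc (swap X (tens Y Z) \oc assoc X Y Z)
    = tensm (idm Y) (swap X Z) \oc
        (assoc Y X Z \oc tensm (swap X Y) (idm Z))
}.

Arguments munit {s}.
Arguments tens {s} X Y.
Arguments tensm {s X Y X' Y'} f g : rename.
Arguments assoc {s} X Y Z.
Arguments associ {s} X Y Z.
Arguments lunit {s} X.
Arguments luniti {s} X.
Arguments runit {s} X.
Arguments runiti {s} X.
Arguments swap {s} X Y.

Definition midswap (C : symMonoidal) (A B A' B' : C) :
    hom (tens (tens A B) (tens A' B')) (tens (tens A A') (tens B B')) :=
  associ A A' (tens B B') \oc
    (tensm (idm A)
       (assoc A' B B' \oc (tensm (swap B A') (idm B') \oc associ B A' B')) \oc
     assoc A B (tens A' B')).

Section SymMonoidalTheory.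
Variable C : symMonoidal.
Implicit Types X Y : C.

Lemma tens1_inj X Y (f g : hom X Y) :
  tensm (idm (@munit C)) f = tensm (idm munit) g -> f = g.
Proof.
move=> E; apply: (cancel_epi (lunitiK X)).
by rewrite -!lunit_nat E.
Qed.

Lemma tensr1_inj X Y (f g : hom X Y) :
  tensm f (idm (@munit C)) = tensm g (idm munit) -> f = g.
Proof.
move=> E; apply: (cancel_epi (runitiK X)).
by rewrite -!runit_nat E.
Qed.

Lemma lunit_assoc X Y :
  lunit (tens X Y) \oc assoc munit X Y = tensm (lunit X) (idm Y).
Proof.
apply: tens1_inj.
apply: (cancel_epi (associK munit (tens munit X) Y)).
apply: (@cancel_epi _ _ _ _ (tensm (assoc munit munit X) (idm Y))
                            (tensm (associ munit munit X) (idm Y))).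
  by rewrite -tensmM associK comp1m tensm1.
have -> : tensm (idm munit) (lunit (tens X Y) \oc assoc munit X Y)
  = tensm (idm munit) (lunit (tens X Y)) \oc tensm (idm munit) (assoc munit X Y).
  by rewrite -tensmM comp1m.
rewrite -!compA pentagon.
rewrite (pre2 (triangle _ _)) -(tensm1 X Y) -assoc_nat -triangle.
by rewrite -{1}(comp1m (idm Y)) tensmM (pre2 (assoc_nat _ _ _)) -compA.
Qed.

Lemma lunit_unit : lunit (@munit C) = runit munit.
Proof.
apply: tensr1_inj.
rewrite -lunit_assoc -triangle; congr (_ \oc _).
apply: (cancel_mono (lunitK munit)).
by rewrite lunit_nat.
Qed.

Lemma lunit_swap X : lunit X \oc swap X munit = runit X.
Proof.
apply: tensr1_inj.
apply: (cancel_mono (swapK X munit)).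
have := f_equal (fun f => lunit _ \oc f) (hexagon X munit munit).
rewrite compA lunit_assoc compA -swap_nat -compA triangle => ->.
rewrite compA lunit_nat -compA (pre2 (lunit_assoc _ _)).
by rewrite -tensmM comp1m.
Qed.

End SymMonoidalTheory.

Record gsMonoidal : Type := GsMonoidal {
  gscat :> symMonoidal;
  copy : forall X : gscat, hom X (tens X X);
  del : forall X : gscat, hom X munit;
  copyA : forall X,
    assoc X X X \oc (tensm (copy X) (idm X) \oc copy X)
    = tensm (idm X) (copy X) \oc copy X;
  copyC : forall X, swap X X \oc copy X = copy X;
  copy_dell : forall X,
    lunit X \oc (tensm (del X) (idm X) \oc copy X) = idm X;
  copy_delr : forall X,
    runit X \oc (tensm (idm X) (del X) \oc copy X) = idm X;
  copy_tens : forall X Y,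
    copy (tens X Y) = midswap X X Y Y \oc tensm (copy X) (copy Y);
  del_tens : forall X Y,
    del (tens X Y) = lunit munit \oc tensm (del X) (del Y);
  copy_unit : copy munit = luniti munit;
  del_unit : del munit = idm munit
}.

Arguments copy {g} X.
Arguments del {g} X.

Section EffectMonoid.
Variables (C : gsMonoidal) (X : C).
Implicit Types a b c : hom X (@munit C).

Definition eff_mul a b : hom X munit :=
  lunit munit \oc (tensm a b \oc copy X).

Lemma eff_mulC a b : eff_mul a b = eff_mul b a.
Proof.
rewrite /eff_mul {1}lunit_unit -lunit_swap -compA (pre2 (swap_nat _ _)).
by rewrite -compA copyC.
Qed.

Lemma eff_mul1 a : eff_mul (del X) a = a.
Proof.
rewrite /eff_mul -{1}(comp1m (del X)) -{1}(compm1 a) tensmM -compA.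
by rewrite (pre2 (lunit_nat _)) -compA copy_dell compm1.
Qed.

Lemma eff_mulA a b c : eff_mul a (eff_mul b c) = eff_mul (eff_mul a b) c.
Proof.
rewrite /eff_mul.
have -> : tensm (lunit munit \oc (tensm a b \oc copy X)) c
  = tensm (lunit munit) (idm munit) \oc
      (tensm (tensm a b) c \oc tensm (copy X) (idm X)).
  by rewrite -!tensmM !compm1 comp1m.
have -> : tensm a (lunit munit \oc (tensm b c \oc copy X))
  = tensm (idm munit) (lunit munit) \oc
      (tensm a (tensm b c) \oc tensm (idm X) (copy X)).
  by rewrite -!tensmM !compm1 comp1m.
rewrite -!compA -copyA (compA (tensm a _)) -assoc_nat -!compA.
by rewrite (pre2 (triangle _ _)) -lunit_unit.
Qed.

Definition eff_monoid : comMonoid :=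
  ComMonoid eff_mulA eff_mulC eff_mul1.

End EffectMonoid.

Definition weakly_markov (C : gsMonoidal) : Prop :=
  forall X : C, is_group (eff_monoid X).

Record cartesian : Type := Cartesian {
  ccat :> category;
  one : ccat;
  bang : forall X : ccat, hom X one;
  bang_uniq : forall (X : ccat) (f : hom X one), f = bang X;
  cprod : ccat -> ccat -> ccat;
  p1 : forall X Y, hom (cprod X Y) X;
  p2 : forall X Y, hom (cprod X Y) Y;
  cpair : forall W X Y : ccat, hom W X -> hom W Y -> hom W (cprod X Y);
  p1_pair : forall W X Y (f : hom W X) (g : hom W Y), p1 X Y \oc cpair f g = f;
  p2_pair : forall W X Y (f : hom W X) (g : hom W Y), p2 X Y \oc cpair f g = g;
  pair_uniq : forall W X Y (h : hom W (cprod X Y)),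
    h = cpair (p1 X Y \oc h) (p2 X Y \oc h)
}.

Arguments one {c}.
Arguments bang {c} X.
Arguments cprod {c} X Y.
Arguments p1 {c X Y}.
Arguments p2 {c X Y}.
Arguments cpair {c W X Y} f g.

Notation "X '\x' Y" := (cprod X Y)
  (at level 40, left associativity, format "X  '\x'  Y") : cat_scope.

Section CartesianTheory.
Variable D : cartesian.
Implicit Types W X Y Z : D.

Definition prodm X Y X' Y' (f : hom X X') (g : hom Y Y') :
    hom (X \x Y) (X' \x Y') :=
  cpair (f \oc p1) (g \oc p2).
Definition passoc X Y Z : hom ((X \x Y) \x Z) (X \x (Y \x Z)) :=
  cpair (p1 \oc p1) (cpair (p2 \oc p1) p2).
Definition passoci X Y Z : hom (X \x (Y \x Z)) ((X \x Y) \x Z) :=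
  cpair (cpair p1 (p1 \oc p2)) (p2 \oc p2).
Definition pswap X Y : hom (X \x Y) (Y \x X) := cpair p2 p1.
Definition diag X : hom X (X \x X) := cpair (idm X) (idm X).

Lemma pair_comp V W X Y (f : hom W X) (g : hom W Y) (k : hom V W) :
  cpair f g \oc k = cpair (f \oc k) (g \oc k).
Proof. by rewrite [LHS]pair_uniq !compA p1_pair p2_pair. Qed.

Lemma pair_ext W X Y (f g : hom W (X \x Y)) :
  p1 \oc f = p1 \oc g -> p2 \oc f = p2 \oc g -> f = g.
Proof. by move=> e1 e2; rewrite (pair_uniq f) (pair_uniq g) e1 e2. Qed.

Lemma bang_ext X (f g : hom X (@one D)) : f = g.
Proof. by rewrite (bang_uniq f) (bang_uniq g). Qed.

Lemma p1_pairA V W X Y (f : hom W X) (g : hom W Y) (k : hom V W) :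
  p1 \oc (cpair f g \oc k) = f \oc k.
Proof. by rewrite compA p1_pair. Qed.

Lemma p2_pairA V W X Y (f : hom W X) (g : hom W Y) (k : hom V W) :
  p2 \oc (cpair f g \oc k) = g \oc k.
Proof. by rewrite compA p2_pair. Qed.

Lemma pair_id X Y : cpair p1 p2 = idm (X \x Y).
Proof. by apply: pair_ext; rewrite ?p1_pair ?p2_pair compm1. Qed.

End CartesianTheory.

Arguments passoc {D} X Y Z.
Arguments passoci {D} X Y Z.
Arguments pswap {D} X Y.
Arguments diag {D} X.

Ltac csimp :=
  rewrite /prodm /passoc /passoci /pswap /diag;
  repeat (progress rewrite ?pair_comp -?compA ?p1_pair ?p2_pair
            ?p1_pairA ?p2_pairA ?pair_id ?comp1m ?compm1).
Ltac cext :=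
  csimp; repeat (first [ reflexivity | apply: bang_ext
                       | apply: pair_ext; csimp ]).

Section CartesianGs.
Variable D : cartesian.

Definition cart_sm : symMonoidal.
Proof.
refine (@SymMonoidal D one (@cprod D) (@prodm D)
  (@passoc D) (@passoci D)
  (fun X => p2) (fun X => cpair (bang X) (idm X))
  (fun X => p1) (fun X => cpair (idm X) (bang X))
  (@pswap D) _ _ _ _ _ _ _ _ _ _ _ _ _ _ _ _); abstract (intros; cext).
Defined.

Definition cart_gs : gsMonoidal.
Proof.
refine (@GsMonoidal cart_sm (@diag D) (@bang D) _ _ _ _ _ _ _ _);
  abstract (rewrite /midswap /=; intros; cext).
Defined.

End CartesianGs.

Section CartesianMaps.
Variable D : cartesian.
Implicit Types W X Y : D.

Lemma prodm_pair W X Y X' Y' (f : hom X X') (g : hom Y Y')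
    (a : hom W X) (b : hom W Y) :
  prodm f g \oc cpair a b = cpair (f \oc a) (g \oc b).
Proof. by cext. Qed.

Lemma prodm1 X Y : prodm (idm X) (idm Y) = idm (X \x Y).
Proof. exact: (@tensm1 (cart_sm D)). Qed.

Lemma prodmM X Y X' Y' X'' Y'' (f' : hom X' X'') (g' : hom Y' Y'')
    (f : hom X X') (g : hom Y Y') :
  prodm (f' \oc f) (g' \oc g) = prodm f' g' \oc prodm f g.
Proof. exact: (@tensmM (cart_sm D)). Qed.

Lemma pswap_pair W X Y (a : hom W X) (b : hom W Y) :
  pswap X Y \oc cpair a b = cpair b a.
Proof. by cext. Qed.

Lemma to_pair X Y (Z : D) (f g : hom (X \x Y) Z) :
  (forall (a : hom (X \x Y) X) (b : hom (X \x Y) Y),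
     f \oc cpair a b = g \oc cpair a b) -> f = g.
Proof.
move=> E; have := E p1 p2.
by rewrite !pair_id !compm1.
Qed.

End CartesianMaps.

Record monad (C : category) : Type := Monad {
  Tob :> C -> C;
  Tm : forall X Y, hom X Y -> hom (Tob X) (Tob Y);
  eta : forall X, hom X (Tob X);
  mu : forall X, hom (Tob (Tob X)) (Tob X);
  Tm1 : forall X, Tm (idm X) = idm (Tob X);
  TmM : forall X Y Z (g : hom Y Z) (f : hom X Y),
    Tm (g \oc f) = Tm g \oc Tm f;
  eta_nat : forall X Y (f : hom X Y), eta Y \oc f = Tm f \oc eta X;
  mu_nat : forall X Y (f : hom X Y), mu Y \oc Tm (Tm f) = Tm f \oc mu X;
  mu_eta : forall X, mu X \oc eta (Tob X) = idm (Tob X);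
  mu_Teta : forall X, mu X \oc Tm (eta X) = idm (Tob X);
  mu_mu : forall X, mu X \oc Tm (mu X) = mu X \oc mu (Tob X)
}.

Arguments Tm {C m X Y} f : rename.
Arguments eta {C m} X : rename.
Arguments mu {C m} X : rename.
Arguments TmM {C m X Y Z} g f : rename.

Record strongMonad (D : cartesian) : Type := StrongMonad {
  smonad :> monad D;
  st : forall X Y : D, hom (X \x smonad Y) (smonad (X \x Y));
  st_nat : forall X Y X' Y' (f : hom X X') (g : hom Y Y'),
    st X' Y' \oc prodm f (Tm g) = Tm (prodm f g) \oc st X Y;
  st_unit : forall X, Tm p2 \oc st one X = p2;
  st_assoc : forall X Y Z,
    Tm (passoc X Y Z) \oc st (X \x Y) Z
    = st X (Y \x Z) \oc (prodm (idm X) (st Y Z) \oc passoc X Y (smonad Z));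
  st_eta : forall X Y, st X Y \oc prodm (idm X) (eta Y) = eta (X \x Y);
  st_mu : forall X Y,
    st X Y \oc prodm (idm X) (mu Y)
    = mu (X \x Y) \oc (Tm (st X Y) \oc st X (smonad Y))
}.

Arguments st {D s} X Y.

(* The other strength, obtained from [st] along the symmetry. *)
Definition cst (D : cartesian) (M : strongMonad D) (X Y : D) :
    hom (M X \x Y) (M (X \x Y)) :=
  Tm (pswap Y X) \oc (st Y X \oc pswap (M X) Y).

Arguments cst {D M} X Y.

Record commMonad (D : cartesian) : Type := CommMonad {
  cmonad :> strongMonad D;
  st_comm : forall X Y : D,
    mu (X \x Y) \oc (Tm (cst X Y) \oc st (cmonad X) Y)
    = mu (X \x Y) \oc (Tm (st X Y) \oc cst X (cmonad Y))
}.

(* The double strength: it makes [M] a lax symmetric monoidal monad, see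
   [dst_nat], [dst_assoc], [dst_swap], [dst_unitl], [dst_eta] and [dst_mu]. *)
Definition dst (D : cartesian) (M : commMonad D) (X Y : D) :
    hom (M X \x M Y) (M (X \x Y)) :=
  mu (X \x Y) \oc (Tm (cst X Y) \oc st (M X) Y).

Arguments dst {D M} X Y.

Section StrongTheory.
Variables (D : cartesian) (M : strongMonad D).
Implicit Types W X Y Z : D.
Local Notation eta := (@eta D M).
Local Notation mu := (@mu D M).
Local Notation st := (@st D M).

Lemma TmMA W X Y Z (g : hom Y Z) (f : hom X Y) (k : hom W (M X)) :
  Tm g \oc (Tm f \oc k) = Tm (g \oc f) \oc k.
Proof. by rewrite TmM compA. Qed.

Lemma st_natE W X Y X' Y' (f : hom X X') (g : hom Y Y')
    (a : hom W X) (m : hom W (M Y)) :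
  st X' Y' \oc cpair (f \oc a) (Tm g \oc m)
  = Tm (prodm f g) \oc (st X Y \oc cpair a m).
Proof. by rewrite compA -st_nat -compA prodm_pair. Qed.

Lemma st_natr W X Y Y' (g : hom Y Y') (a : hom W X) (m : hom W (M Y)) :
  st X Y' \oc cpair a (Tm g \oc m)
  = Tm (prodm (idm X) g) \oc (st X Y \oc cpair a m).
Proof. by rewrite -st_natE comp1m. Qed.

Lemma st_natl W X Y X' (f : hom X X') (a : hom W X) (m : hom W (M Y)) :
  st X' Y \oc cpair (f \oc a) m
  = Tm (prodm f (idm Y)) \oc (st X Y \oc cpair a m).
Proof. by rewrite -st_natE Tm1 comp1m. Qed.

Lemma st_assocE W X Y Z (a : hom W X) (b : hom W Y) (m : hom W (M Z)) :
  st X (Y \x Z) \oc cpair a (st Y Z \oc cpair b m)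
  = Tm (passoc X Y Z) \oc (st (X \x Y) Z \oc cpair (cpair a b) m).
Proof. by rewrite compA st_assoc; csimp. Qed.

Lemma st_swapE W X Y Z (a : hom W X) (b : hom W Y) (m : hom W (M Z)) :
  st (X \x Y) Z \oc cpair (cpair a b) m
  = Tm (prodm (pswap Y X) (idm Z)) \oc (st (Y \x X) Z \oc cpair (cpair b a) m).
Proof. by rewrite -st_natl pswap_pair. Qed.

Lemma st_etaE W X Y (a : hom W X) (b : hom W Y) :
  st X Y \oc cpair a (eta Y \oc b) = eta (X \x Y) \oc cpair a b.
Proof. by rewrite -st_eta -compA prodm_pair comp1m. Qed.

Lemma st_muE W X Y (a : hom W X) (m : hom W (M (M Y))) :
  st X Y \oc cpair a (mu Y \oc m)
  = mu (X \x Y) \oc (Tm (st X Y) \oc (st X (M Y) \oc cpair a m)).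
Proof. by rewrite (compA (Tm _)) compA -st_mu -compA prodm_pair comp1m. Qed.

Lemma cstE W X Y (m : hom W (M X)) (b : hom W Y) :
  cst X Y \oc cpair m b = Tm (pswap Y X) \oc (st Y X \oc cpair b m).
Proof. by rewrite /cst -!compA pswap_pair. Qed.

Lemma cst_def X Y : @cst D M X Y = Tm (pswap Y X) \oc (st Y X \oc cpair p2 p1).
Proof. by []. Qed.

Local Notation cst := (@cst D M).

Lemma cst_nat X Y X' Y' (f : hom X X') (g : hom Y Y') :
  cst X' Y' \oc prodm (Tm f) g = Tm (prodm f g) \oc cst X Y.
Proof.
apply: to_pair => a b.
rewrite -(compA (cst _ _)) prodm_pair -(compA (Tm _)) !cstE st_natE !TmMA; congr (Tm _ \oc _); cext.
Qed.

Lemma cst_mu X Y :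
  cst X Y \oc prodm (mu X) (idm Y)
  = mu (X \x Y) \oc (Tm (cst X Y) \oc cst (M X) Y).
Proof.
apply: to_pair => a b.
rewrite -(compA (cst _ _)) prodm_pair cstE comp1m st_muE.
rewrite -(compA (mu _)) -(compA (Tm _)) cstE compA -mu_nat -(compA (mu _)) !TmMA.
congr (_ \oc (Tm _ \oc _)).
by rewrite cst_def; cext.
Qed.

Lemma cst_assoc X Y Z :
  cst X (Y \x Z) \oc passoc (M X) Y Z
  = Tm (passoc X Y Z) \oc (cst (X \x Y) Z \oc prodm (cst X Y) (idm Z)).
Proof.
apply: to_pair => mb c.
have -> : mb = cpair (p1 \oc mb) (p2 \oc mb) by exact: pair_uniq.
move: (p1 \oc mb) (p2 \oc mb) => m b.
rewrite -(compA (cst _ _)).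
have -> : passoc (M X) Y Z \oc cpair (cpair m b) c = cpair m (cpair b c) by cext.
rewrite -(compA (Tm _)) -(compA (cst _ _)) prodm_pair !cstE comp1m.
rewrite st_natr st_assocE.
by rewrite st_swapE !TmMA; congr (Tm _ \oc _); cext.
Qed.

Lemma cst_eta X Y : cst X Y \oc prodm (eta X) (idm Y) = eta (X \x Y).
Proof.
apply: to_pair => a b.
rewrite -(compA (cst _ _)) prodm_pair cstE comp1m st_etaE.
by rewrite compA -eta_nat -compA pswap_pair.
Qed.

Lemma st_cst_assoc X Y Z :
  Tm (passoc X Y Z) \oc (cst (X \x Y) Z \oc prodm (st X Y) (idm Z))
  = st X (Y \x Z) \oc (prodm (idm X) (cst Y Z) \oc passoc X (M Y) Z).
Proof.
apply: to_pair => am c.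
have -> : am = cpair (p1 \oc am) (p2 \oc am) by exact: pair_uniq.
move: (p1 \oc am) (p2 \oc am) => a m.
rewrite -(compA (Tm _)) -(compA (cst _ _)) -(compA (st _ _)).
rewrite -(compA (prodm _ _)).
have -> : passoc X (M Y) Z \oc cpair (cpair a m) c = cpair a (cpair m c) by cext.
rewrite !prodm_pair !cstE !comp1m st_natr !st_assocE.
by rewrite (st_swapE a) !TmMA; congr (Tm _ \oc _); cext.
Qed.

Lemma prodm1M X Y Y' Y'' (g : hom Y' Y'') (f : hom Y Y') :
  prodm (idm X) (g \oc f) = prodm (idm X) g \oc prodm (idm X) f.
Proof. by rewrite -prodmM comp1m. Qed.

Lemma prodmM1 X Y Y' Y'' (g : hom Y' Y'') (f : hom Y Y') :
  prodm (g \oc f) (idm X) = prodm g (idm X) \oc prodm f (idm X).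
Proof. by rewrite -prodmM comp1m. Qed.

Lemma prodm_split X Y X' Y' (f : hom X X') (g : hom Y Y') :
  prodm f g = prodm f (idm Y') \oc prodm (idm X) g.
Proof. by rewrite -prodmM comp1m compm1. Qed.

End StrongTheory.

Section CommTheory.
Variables (D : cartesian) (M : commMonad D).
Implicit Types W X Y Z : D.
Local Notation eta := (@eta D M).
Local Notation mu := (@mu D M).
Local Notation st := (@st D M).
Local Notation cst := (@cst D M).
Local Notation dst := (@dst D M).

Lemma dst_l X Y : dst X Y = mu (X \x Y) \oc (Tm (cst X Y) \oc st (M X) Y).
Proof. by []. Qed.

Lemma dst_r X Y : dst X Y = mu (X \x Y) \oc (Tm (st X Y) \oc cst X (M Y)).
Proof. exact: st_comm. Qed.

Lemma dst_nat X Y X' Y' (f : hom X X') (g : hom Y Y') :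
  dst X' Y' \oc prodm (Tm f) (Tm g) = Tm (prodm f g) \oc dst X Y.
Proof.
rewrite !dst_l -(compA (mu _)) -(compA (Tm _)) st_nat.
by rewrite (compA (Tm (cst _ _))) -TmM cst_nat TmM compA compA mu_nat -!compA.
Qed.

Lemma dst_eta X Y : dst X Y \oc prodm (eta X) (eta Y) = eta (X \x Y).
Proof.
rewrite dst_r prodm_split -(compA (mu _)) -(compA (Tm _)) (compA (cst _ _)).
rewrite -[idm (M Y)]Tm1.
have -> : prodm (eta X) (Tm (idm Y)) = prodm (eta X) (idm (M Y)) by rewrite Tm1.
rewrite cst_eta eta_nat (compA (Tm (st _ _))) -TmM st_eta.
by rewrite compA mu_Teta comp1m.
Qed.

Lemma dst_mul X Y :
  dst X Y \oc prodm (mu X) (idm (M Y))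
  = mu (X \x Y) \oc (Tm (dst X Y) \oc cst (M X) (M Y)).
Proof.
rewrite {1}dst_r -(compA (mu _)) -(compA (Tm _)) cst_mu.
rewrite (compA (Tm _) (mu _)) -mu_nat -(compA (mu _)) compA -mu_mu.
by rewrite -compA dst_r !TmM -!compA.
Qed.

Lemma dst_mur X Y :
  dst X Y \oc prodm (idm (M X)) (mu Y)
  = mu (X \x Y) \oc (Tm (dst X Y) \oc st (M X) (M Y)).
Proof.
rewrite {1}dst_l -(compA (mu _)) -(compA (Tm _)) st_mu.
rewrite (compA (Tm _) (mu _)) -mu_nat -(compA (mu _)) compA -mu_mu.
by rewrite -compA dst_l !TmM -!compA.
Qed.

Lemma dst_mu X Y :
  dst X Y \oc prodm (mu X) (mu Y)
  = mu (X \x Y) \oc (Tm (dst X Y) \oc dst (M X) (M Y)).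
Proof.
rewrite prodm_split compA dst_mul -(compA (mu _)) -(compA (Tm _)).
rewrite -Tm1 cst_nat (compA (Tm (dst _ _))) -TmM dst_mur.
rewrite (dst_r (M X)) (TmM (mu _)) (TmM (Tm _)).
rewrite -(compA (Tm (mu _))) -(compA (Tm (Tm _))).
rewrite (compA (Tm (dst X Y)) (mu _)) -mu_nat -(compA (mu _)).
by rewrite (compA (mu _) (mu _)) -mu_mu -(compA (mu _)).
Qed.

Lemma dst_swap X Y :
  Tm (pswap X Y) \oc dst X Y = dst Y X \oc pswap (M X) (M Y).
Proof.
have cE A B : cst A B = Tm (pswap B A) \oc (st B A \oc pswap (M A) B) by [].
rewrite dst_r dst_l compA -mu_nat -!(compA (mu _)); congr (_ \oc _).
rewrite (cE X (M Y)) (cE Y X) -(compA (Tm (_ \oc _))) !TmM.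
by rewrite -!(compA (Tm _)).
Qed.

Lemma dst_unitl Y : Tm p2 \oc (dst one Y \oc prodm (eta one) (idm (M Y))) = p2.
Proof.
rewrite dst_r -(compA (mu _)) -(compA (Tm _)) cst_eta -eta_nat (compA (mu _)) mu_eta comp1m.
exact: st_unit.
Qed.

Lemma dst_unitr X : Tm p1 \oc (dst X one \oc prodm (idm (M X)) (eta one)) = p1.
Proof.
have -> : @p1 D X one = p2 \oc pswap X one by cext.
rewrite TmM -compA (compA _ (dst _ _)) dst_swap -compA.
have -> : pswap (M X) (M one) \oc prodm (idm (M X)) (eta one)
  = prodm (eta one) (idm (M X)) \oc pswap (M X) one by cext.
by rewrite (compA (dst _ _)) compA dst_unitl; cext.
Qed.

Lemma st_dst_assoc X Y Z :
  Tm (passoc X Y Z) \oc (dst (X \x Y) Z \oc prodm (st X Y) (idm (M Z)))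
  = st X (Y \x Z) \oc
      (prodm (idm X) (dst Y Z) \oc passoc X (M Y) (M Z)).
Proof.
rewrite dst_r -(compA (mu _)) -(compA (Tm _)).
rewrite (compA (Tm _) (mu _)) -mu_nat -(compA (mu _)).
rewrite (compA (Tm (Tm _))) -TmM st_assoc !TmM -!(compA (Tm (st _ _))).
rewrite -(compA (Tm (prodm _ _))) st_cst_assoc.
rewrite (compA (Tm (prodm _ _))) -st_nat -(compA (st _ _)).
rewrite dst_r (prodm1M X (mu _)) -(compA (prodm (idm X) (mu _))).
rewrite (compA (st X (Y \x Z))) st_mu -(compA (mu _)).
rewrite (prodm1M X (Tm (st _ _))) -(compA (prodm (idm X) (Tm _))).
by rewrite -(compA (Tm _)).
Qed.

Lemma dst_assoc X Y Z :
  Tm (passoc X Y Z) \oc (dst (X \x Y) Z \oc prodm (dst X Y) (idm (M Z)))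
  = dst X (Y \x Z) \oc
      (prodm (idm (M X)) (dst Y Z) \oc passoc (M X) (M Y) (M Z)).
Proof.
transitivity (mu (X \x (Y \x Z)) \oc
  (Tm (st X (Y \x Z) \oc prodm (idm X) (dst Y Z)) \oc
    (cst X (M Y \x M Z) \oc passoc (M X) (M Y) (M Z)))); last first.
  rewrite (dst_r X) -(compA (mu _)) -(compA (Tm _)) -Tm1.
  by rewrite (compA (cst _ _)) cst_nat TmM -(compA (Tm (prodm _ _))) -compA.
set K := prodm (cst X (M Y)) (idm (M Z)).
have cA : cst X (M Y \x M Z) \oc passoc (M X) (M Y) (M Z)
  = Tm (passoc X (M Y) (M Z)) \oc (cst (X \x M Y) (M Z) \oc K).
  exact: cst_assoc.
have -> : prodm (dst X Y) (idm (M Z))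
  = prodm (mu (X \x Y)) (idm (M Z)) \oc
      (prodm (Tm (st X Y)) (idm (M Z)) \oc K).
  by rewrite dst_r prodmM1 (prodmM1 _ (Tm _) (cst _ _)).
clearbody K.
rewrite cA (compA (dst _ _)) dst_mul -(compA (mu _)) -(compA (Tm (dst _ _))).
rewrite (compA (cst (M _) _)) cst_nat -(compA (Tm (prodm _ _))).
rewrite (compA (Tm _) (mu _)) -mu_nat -(compA (mu _)).
rewrite (compA (Tm (dst _ _))) -TmM (compA (Tm (Tm _))) -TmM st_dst_assoc.
by rewrite (compA (Tm _) (Tm (passoc _ _ _))) -TmM (compA (st _ _)).
Qed.

End CommTheory.

Arguments dst_nat {D M X Y X' Y'} f g.

Section Kleisli.
Variables (D : cartesian) (M : commMonad D).
Local Notation eta := (@eta D M).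
Local Notation mu := (@mu D M).
Local Notation dst := (@dst D M).

Definition kl_hom (X Y : D) : Type := hom X (M Y).
Definition kl_comp (X Y Z : D) (g : kl_hom Y Z) (f : kl_hom X Y) :
  kl_hom X Z := mu Z \oc (Tm g \oc f).

Lemma kl_compA (W X Y Z : D)
    (h : kl_hom Y Z) (g : kl_hom X Y) (f : kl_hom W X) :
  kl_comp h (kl_comp g f) = kl_comp (kl_comp h g) f.
Proof.
rewrite /kl_comp !TmM -!compA (pre2 (mu_mu M Z)) -!compA.
by rewrite (pre2 (mu_nat M h)) -!compA.
Qed.

Lemma kl_comp1m (X Y : D) (f : kl_hom X Y) : kl_comp (eta Y) f = f.
Proof. by rewrite /kl_comp compA mu_Teta comp1m. Qed.

Lemma kl_compm1 (X Y : D) (f : kl_hom X Y) : kl_comp f (eta X) = f.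
Proof. by rewrite /kl_comp -eta_nat compA mu_eta comp1m. Qed.

Definition kl_cat : category :=
  @Category D kl_hom eta kl_comp kl_compA kl_comp1m kl_compm1.

Definition kl_pure (X Y : D) (f : hom X Y) : kl_hom X Y := eta Y \oc f.

Definition kl_tensm (X Y X' Y' : D) (f : kl_hom X X') (g : kl_hom Y Y') :
    kl_hom (X \x Y) (X' \x Y') :=
  dst X' Y' \oc prodm f g.

Lemma kl_pure1 (X : D) : kl_pure (idm X) = eta X.
Proof. exact: compm1. Qed.

Lemma kl_comp_purel (X Y Z : D) (g : hom Y Z) (f : kl_hom X Y) :
  kl_comp (kl_pure g) f = Tm g \oc f.
Proof. by rewrite /kl_comp /kl_pure TmM compA compA mu_Teta comp1m. Qed.

Lemma kl_comp_purer (X Y Z : D) (g : kl_hom Y Z) (f : hom X Y) :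
  kl_comp g (kl_pure f) = g \oc f.
Proof. by rewrite -{2}(kl_compm1 g) /kl_comp /kl_pure -!compA. Qed.

Lemma kl_pureM (X Y Z : D) (g : hom Y Z) (f : hom X Y) :
  kl_comp (kl_pure g) (kl_pure f) = kl_pure (g \oc f).
Proof. by rewrite kl_comp_purer /kl_pure compA. Qed.

Lemma kl_tensm_pure (X Y X' Y' : D) (f : hom X X') (g : hom Y Y') :
  kl_tensm (kl_pure f) (kl_pure g) = kl_pure (prodm f g).
Proof. by rewrite /kl_tensm prodmM (compA (dst _ _)) dst_eta. Qed.

Lemma kl_tensm_purel (X Y X' Y' : D) (f : hom X X') (g : kl_hom Y Y') :
  kl_tensm (kl_pure f) g = dst X' Y' \oc (prodm (eta X') (idm _) \oc prodm f g).
Proof. by rewrite /kl_tensm -prodmM comp1m. Qed.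

Lemma kl_tensmM (X Y X' Y' X'' Y'' : D)
    (f' : kl_hom X' X'') (g' : kl_hom Y' Y'')
    (f : kl_hom X X') (g : kl_hom Y Y') :
  kl_tensm (kl_comp f' f) (kl_comp g' g)
  = kl_comp (kl_tensm f' g') (kl_tensm f g).
Proof.
rewrite /kl_tensm /kl_comp !prodmM (compA (dst _ _)) dst_mu.
rewrite -(compA (mu _)) -(compA (Tm _)) (compA (dst (M _) _)) dst_nat.
by rewrite TmM -(compA (Tm (prodm _ _))) -(compA (Tm (dst _ _))).
Qed.

Lemma kl_assoc_nat (X Y Z X' Y' Z' : D)
    (f : kl_hom X X') (g : kl_hom Y Y') (h : kl_hom Z Z') :
  kl_comp (kl_pure (passoc X' Y' Z')) (kl_tensm (kl_tensm f g) h)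
  = kl_comp (kl_tensm f (kl_tensm g h)) (kl_pure (passoc X Y Z)).
Proof.
rewrite kl_comp_purel kl_comp_purer /kl_tensm.
have -> : prodm (dst X' Y' \oc prodm f g) h
  = prodm (dst X' Y') (idm _) \oc prodm (prodm f g) h.
  by rewrite -prodmM comp1m.
rewrite (compA (dst _ Z')) compA dst_assoc -!(compA (dst X' _)).
congr (_ \oc _).
have -> : prodm f (dst Y' Z' \oc prodm g h)
  = prodm (idm _) (dst Y' Z') \oc prodm f (prodm g h).
  by rewrite -prodmM comp1m.
rewrite -!(compA (prodm (idm _) _)); congr (_ \oc _); cext.
Qed.

Lemma kl_swap_nat (X Y X' Y' : D) (f : kl_hom X X') (g : kl_hom Y Y') :
  kl_comp (kl_pure (pswap X' Y')) (kl_tensm f g)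
  = kl_comp (kl_tensm g f) (kl_pure (pswap X Y)).
Proof.
rewrite kl_comp_purel kl_comp_purer /kl_tensm compA dst_swap.
by rewrite -!(compA (dst _ _)); congr (_ \oc _); cext.
Qed.

Lemma kl_lunit_nat (X Y : D) (f : kl_hom X Y) :
  kl_comp (kl_pure p2) (kl_tensm (eta one) f) = kl_comp f (kl_pure p2).
Proof.
rewrite kl_comp_purel kl_comp_purer -(kl_pure1 one) kl_tensm_purel.
by rewrite (compA (dst _ _)) compA dst_unitl; cext.
Qed.

Lemma kl_runit_nat (X Y : D) (f : kl_hom X Y) :
  kl_comp (kl_pure p1) (kl_tensm f (eta one)) = kl_comp f (kl_pure p1).
Proof.
rewrite kl_comp_purel kl_comp_purer /kl_tensm.
have -> : prodm f (eta one)
  = prodm (idm _) (eta one) \oc prodm f (idm _).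
  by rewrite -prodmM comp1m compm1.
by rewrite (compA (dst _ _)) compA dst_unitr; cext.
Qed.

Definition kl_sm : symMonoidal.
Proof.
refine (@SymMonoidal kl_cat one (@cprod D) kl_tensm
  (fun X Y Z => kl_pure (passoc X Y Z)) (fun X Y Z => kl_pure (passoci X Y Z))
  (fun X => kl_pure (lunit (X : cart_sm D)))
  (fun X => kl_pure (luniti (X : cart_sm D)))
  (fun X => kl_pure (runit (X : cart_sm D)))
  (fun X => kl_pure (runiti (X : cart_sm D)))
  (fun X Y => kl_pure (pswap X Y)) _ _ _ _ _ _ _ _ _
  kl_assoc_nat kl_lunit_nat kl_runit_nat kl_swap_nat _ _ _).
all: cbn.
exact: dst_eta.
exact: kl_tensmM.
all: abstract (intros; rewrite -?kl_pure1 ?kl_tensm_pure ?kl_pureM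
                 ?kl_tensm_pure ?kl_pureM; congr (kl_pure _); cext).
Defined.

Definition kl : gsMonoidal.
Proof.
refine (@GsMonoidal kl_sm (fun X => kl_pure (diag X))
  (fun X => kl_pure (bang X)) _ _ _ _ _ _ _ _); rewrite /midswap; cbn.
all: abstract (intros; rewrite -?kl_pure1 ?kl_tensm_pure;
               repeat (rewrite ?kl_pureM ?kl_tensm_pure);
               congr (kl_pure _); cext).
Defined.

End Kleisli.

Record internalComMonoid (D : cartesian) : Type := InternalComMonoid {
  im_car :> D;
  im_one : hom one im_car;
  im_mul : hom (im_car \x im_car) im_car;
  im_mulA :
    im_mul \oc (prodm (idm im_car) im_mul \oc passoc im_car im_car im_car)
    = im_mul \oc prodm im_mul (idm im_car);
  im_mulC : im_mul \oc pswap im_car im_car = im_mul;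
  im_mul1 : im_mul \oc prodm im_one (idm im_car) = p2
}.

Definition is_internal_group (D : cartesian) (G : internalComMonoid D) : Prop :=
  exists inv : hom G G,
    im_mul G \oc cpair (idm G) inv = im_one G \oc bang G /\
    im_mul G \oc cpair inv (idm G) = im_one G \oc bang G.

Section UnitMonoid.
Variables (D : cartesian) (M : commMonad D).
Local Notation eta := (@eta D M).
Local Notation dst := (@dst D M).

(* [Tm p2] is the isomorphism [M (one \x one) -> M one]. *)
Definition unit_mul : hom (M one \x M one) (M one) := Tm p2 \oc dst one one.

Lemma unit_mulA :
  unit_mul \oc (prodm (idm _) unit_mul \oc passoc _ _ _)
  = unit_mul \oc prodm unit_mul (idm _).
Proof.
rewrite /unit_mul.
have -> : prodm (idm (M one)) (Tm p2 \oc dst one one)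
  = prodm (Tm (idm one)) (Tm p2) \oc prodm (idm (M one)) (dst one one).
  by rewrite -prodmM Tm1 comp1m.
have -> : prodm (Tm p2 \oc dst one one) (idm (M one))
  = prodm (Tm p2) (Tm (idm one)) \oc prodm (dst one one) (idm (M one)).
  by rewrite -prodmM Tm1 comp1m.
rewrite -!(compA (Tm p2)) -(compA (prodm (Tm (idm one)) _)).
rewrite !(compA (dst one one)) !dst_nat -!(compA (Tm (prodm _ _))).
rewrite -dst_assoc !TmMA.
congr (Tm _ \oc _); exact: bang_ext.
Qed.

Lemma unit_mulC : unit_mul \oc pswap _ _ = unit_mul.
Proof.
rewrite /unit_mul -(compA (Tm p2)) -dst_swap compA -TmM.
congr (Tm _ \oc _); exact: bang_ext.
Qed.

Lemma unit_mul1 : unit_mul \oc prodm (eta one) (idm _) = p2.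
Proof. by rewrite /unit_mul -(compA (Tm p2)) dst_unitl. Qed.

Definition unit_monoid : internalComMonoid D :=
  InternalComMonoid unit_mulA unit_mulC unit_mul1.

End UnitMonoid.

Definition weakly_affine (D : cartesian) (M : commMonad D) : Prop :=
  is_internal_group (unit_monoid M).

(* The suppressed associators are made explicit: the upper left corner is
   [(M X \x M Y) \x M Z] and the lower right one is [M (X \x (Y \x Z))]. *)
Definition assoc_square_pullback (D : cartesian) (M : commMonad D)
    (X Y Z : D) : Prop :=
  is_pullback
    (prodm (idm (M X)) (dst Y Z) \oc passoc (M X) (M Y) (M Z))
    (prodm (dst X Y) (idm (M Z)))
    (dst X (Y \x Z))
    (Tm (passoc X Y Z) \oc dst (X \x Y) Z).

(* Main.v *)
From Corelib Require Import ssreflect.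
Require Import Defs.

Set Implicit Arguments.
Unset Strict Implicit.
Unset Printing Implicit Defensive.

Local Open Scope cat_scope.

(** The argument uses generalized elements.  A map [s : hom W (M one)] is a
    scalar: it rescales every [x : hom W (M X)], by tensoring and then removing
    the factor [one].  For [X = one] this rescaling is the multiplication of
    the monoid [M one], and it is also the product of effects in the Kleisli
    category; so weak affinity and the weak Markov property both say that
    every scalar, at every stage [W], has an inverse.  The first says so for the
    generic scalar [idm (M one)], from which all others follow by
    precomposition.

    The pullback condition is related to this through the mass [mass x] of an
    element, its image in [M one].  Rescaling passes through tensors and
    through maps [Tm f], and a marginal of a tensor [x * y] is one factor
    rescaled by the mass of the other.

    If scalars are invertible, suppose that [p * n = m * r] with [p], [r], [n],
    [m] over [X], [Z], [Y \x Z], [X \x Y], and write [m'], [n'] for the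
    marginals of [m], [n] on [Y].  A solution [q] of [p * q = m], [q * r = n]
    satisfies [mass p . q = m'], so it can only be [(mass p)^-1 . m'].
    Removing [X] from [p * n = m * r] gives [mass p . n = m' * r], that is
    [q * r = n].  Removing [Z] gives [p * n' = mass r . m], and removing both
    gives [mass p . n' = mass r . m'], so that [q = (mass r)^-1 . n'] as well
    and [p * q = m].

    Conversely, at [X = Y = Z = one] an element of the pullback over
    [a * 1 = 1 * a] contains a scalar [y] with [a * y = 1]. *)

Section Scalars.
Variables (D : cartesian) (M : commMonad D).
Implicit Types V W X Y Z : D.

Definition tensel W X Y (x : hom W (M X)) (y : hom W (M Y)) :
    hom W (M (X \x Y)) :=
  dst X Y \oc cpair x y.

Definition scale W X (s : hom W (M one)) (x : hom W (M X)) : hom W (M X) :=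
  Tm p2 \oc tensel s x.

Definition scal1 W : hom W (M one) := eta one \oc bang W.

Definition mass W X (x : hom W (M X)) : hom W (M one) := Tm (bang X) \oc x.

Definition scalars_invertible : Prop :=
  forall W (s : hom W (M one)), exists t, scale s t = scal1 W.

(** * Tensors and scalars on generalized elements *)

Lemma tensel_comp V W X Y (x : hom W (M X)) (y : hom W (M Y)) (k : hom V W) :
  tensel x y \oc k = tensel (x \oc k) (y \oc k).
Proof. by rewrite /tensel -compA pair_comp. Qed.

Lemma tensel_nat W X Y X' Y' (f : hom X X') (g : hom Y Y')
    (x : hom W (M X)) (y : hom W (M Y)) :
  tensel (Tm f \oc x) (Tm g \oc y) = Tm (prodm f g) \oc tensel x y.
Proof. by rewrite /tensel -prodm_pair compA dst_nat -compA. Qed.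

Lemma tensel_natl W X Y X' (f : hom X X') (x : hom W (M X)) (y : hom W (M Y)) :
  tensel (Tm f \oc x) y = Tm (prodm f (idm Y)) \oc tensel x y.
Proof. by rewrite -tensel_nat Tm1 comp1m. Qed.

Lemma tensel_natr W X Y Y' (g : hom Y Y') (x : hom W (M X)) (y : hom W (M Y)) :
  tensel x (Tm g \oc y) = Tm (prodm (idm X) g) \oc tensel x y.
Proof. by rewrite -tensel_nat Tm1 comp1m. Qed.

Lemma tensel_swap W X Y (x : hom W (M X)) (y : hom W (M Y)) :
  Tm (pswap X Y) \oc tensel x y = tensel y x.
Proof. by rewrite /tensel compA dst_swap -compA pswap_pair. Qed.

Lemma tensel_assoc W X Y Z
    (x : hom W (M X)) (y : hom W (M Y)) (z : hom W (M Z)) :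
  Tm (passoc X Y Z) \oc tensel (tensel x y) z = tensel x (tensel y z).
Proof.
rewrite /tensel.
have <- : prodm (dst X Y) (idm (M Z)) \oc cpair (cpair x y) z
  = cpair (dst X Y \oc cpair x y) z by rewrite prodm_pair comp1m.
rewrite (compA (dst _ _)) compA dst_assoc -(compA (dst _ _)).
by congr (_ \oc _); cext.
Qed.

Lemma scal1_comp V W (k : hom V W) : scal1 W \oc k = scal1 V.
Proof. by rewrite /scal1 -compA; congr (_ \oc _); apply: bang_ext. Qed.

Lemma scale_comp V W X (s : hom W (M one)) (x : hom W (M X)) (k : hom V W) :
  scale s x \oc k = scale (s \oc k) (x \oc k).
Proof. by rewrite /scale -compA tensel_comp. Qed.

Lemma scale1 W X (x : hom W (M X)) : scale (scal1 W) x = x.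
Proof.
rewrite /scale /tensel.
have <- : prodm (eta one) (idm (M X)) \oc cpair (bang W) x
  = cpair (scal1 W) x by rewrite prodm_pair comp1m.
by rewrite (compA (dst _ _)) compA dst_unitl p2_pair.
Qed.

Lemma scaleC W (s t : hom W (M one)) : scale s t = scale t s.
Proof.
rewrite /scale -(tensel_swap s t) compA -TmM.
by congr (Tm _ \oc _); apply: bang_ext.
Qed.

Lemma scale_nat W X Y (f : hom X Y) (s : hom W (M one)) (x : hom W (M X)) :
  Tm f \oc scale s x = scale s (Tm f \oc x).
Proof. by rewrite /scale tensel_natr !TmMA; congr (Tm _ \oc _); cext. Qed.

Lemma tensel_scalel W X Y (s : hom W (M one)) (x : hom W (M X))
    (y : hom W (M Y)) :
  tensel (scale s x) y = scale s (tensel x y).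
Proof.
by rewrite /scale tensel_natl -tensel_assoc TmMA; congr (Tm _ \oc _); cext.
Qed.

(** By symmetry of the tensor, a scalar may equally well be pulled out of the
    right factor. *)
Lemma tensel_scaler W X Y (s : hom W (M one)) (x : hom W (M X))
    (y : hom W (M Y)) :
  tensel x (scale s y) = scale s (tensel x y).
Proof. by rewrite -tensel_swap tensel_scalel scale_nat tensel_swap. Qed.

Lemma scaleM W X (s t : hom W (M one)) (x : hom W (M X)) :
  scale (scale s t) x = scale s (scale t x).
Proof. by rewrite {1}/scale tensel_scalel scale_nat. Qed.

Lemma scale_cancel W X (s t : hom W (M one)) (x y : hom W (M X)) :
  scale s t = scal1 W -> scale s x = scale s y -> x = y.
Proof.
rewrite scaleC => ts1 sxy.
by rewrite -(scale1 x) -(scale1 y) -ts1 !scaleM sxy.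
Qed.

(** Discarding [X] first is harmless for the projection onto [Y], and it turns
    the left factor into a scalar. *)
Lemma marginal2 W X Y (x : hom W (M X)) (y : hom W (M Y)) :
  Tm p2 \oc tensel x y = scale (mass x) y.
Proof. by rewrite /scale tensel_natl TmMA; congr (Tm _ \oc _); cext. Qed.

Lemma marginal1 W X Y (x : hom W (M X)) (y : hom W (M Y)) :
  Tm p1 \oc tensel x y = scale (mass y) x.
Proof.
by rewrite -marginal2 -(tensel_swap x y) TmMA; congr (Tm _ \oc _); cext.
Qed.

(** * Weak affinity and the weak Markov property *)

Lemma unit_mul_pair W (s t : hom W (M one)) :
  unit_mul M \oc cpair s t = scale s t.
Proof. by rewrite /unit_mul -compA. Qed.

(** An inverse of the generic scalar [idm (M one)] is an inversion map, and
    precomposing it with [s] inverts [s]. *)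
Lemma weakly_affineP : weakly_affine M <-> scalars_invertible.
Proof.
split=> [[inv /= [inv1 _]] W s | inv].
  exists (inv \oc s).
  move: (f_equal (fun h => h \oc s) inv1).
  by rewrite unit_mul_pair scale_comp comp1m scal1_comp.
have [t t1] := inv _ (idm (M one)).
by exists t; split; rewrite /= unit_mul_pair // scaleC.
Qed.

Lemma kl_eff_mul W (a b : hom W (M one)) :
  @eff_mul (kl M) W a b = scale a b.
Proof.
rewrite /eff_mul /= kl_comp_purel kl_comp_purer /kl_tensm /scale /tensel.
by congr (_ \oc _); rewrite -compA prodm_pair !compm1.
Qed.

Lemma weakly_markovP : weakly_markov (kl M) <-> scalars_invertible.
Proof.
split=> inv W s.
  have [t [st1 _]] := inv W s.
  by exists t; rewrite -kl_eff_mul.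
have [t st1] := inv W s.
by exists t; split; rewrite /= kl_eff_mul // scaleC.
Qed.

(** * The associativity square *)

Lemma cpair_inj W X Y (f f' : hom W X) (g g' : hom W Y) :
  cpair f g = cpair f' g' -> f = f' /\ g = g'.
Proof.
move=> E; split.
  by rewrite -(p1_pair f g) E p1_pair.
by rewrite -(p2_pair f g) E p2_pair.
Qed.

(** The pullback property of the associativity square, on generalized
    elements: the outer terms [p], [r] of the triple can be read off the cone,
    so that only the middle one is to be found. *)
Definition unique_refinement X Y Z : Prop :=
  forall W (p : hom W (M X)) (n : hom W (M (Y \x Z)))
      (m : hom W (M (X \x Y))) (r : hom W (M Z)),
    tensel p n = Tm (passoc X Y Z) \oc tensel m r ->
    exists! q : hom W (M Y), tensel p q = m /\ tensel q r = n.

Lemma assoc_square_pullbackP X Y Z :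
  assoc_square_pullback M X Y Z <-> unique_refinement X Y Z.
Proof.
have leftE W (p : hom W (M X)) (q : hom W (M Y)) (r : hom W (M Z)) :
    prodm (idm (M X)) (dst Y Z) \oc passoc (M X) (M Y) (M Z)
      \oc cpair (cpair p q) r = cpair p (tensel q r).
  by rewrite /tensel; cext.
have rightE W (p : hom W (M X)) (q : hom W (M Y)) (r : hom W (M Z)) :
    prodm (dst X Y) (idm (M Z)) \oc cpair (cpair p q) r
    = cpair (tensel p q) r.
  by rewrite /tensel; cext.
split=> [[_ pb] W p n m r E | ref].
  have [|u [[]]] := pb W (cpair p n) (cpair m r).
    by rewrite -compA.
  rewrite (pair_uniq u) (pair_uniq (p1 \oc u)).
  move: (p1 \oc (p1 \oc u)) (p2 \oc (p1 \oc u)) (p2 \oc u) => p' q r'.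
  rewrite leftE rightE => /cpair_inj [-> qr] /cpair_inj [pq r'E].
  rewrite r'E in qr * => uniq.
  exists q; split=> [// | q' [pq' qr']].
  have /cpair_inj [/cpair_inj [_ ->] _] // :
      cpair (cpair p q) r = cpair (cpair p q') r.
  by apply: uniq; rewrite leftE rightE pq' qr'.
split=> [|W a b]; first by rewrite -compA dst_assoc.
rewrite (pair_uniq a) (pair_uniq b).
move: (p1 \oc a) (p2 \oc a) (p1 \oc b) (p2 \oc b) => p n m r.
rewrite -(compA (Tm _)) => /ref [q [[pq qr] uniq]].
exists (cpair (cpair p q) r); split=> [|u []].
  by rewrite leftE rightE pq qr.
rewrite (pair_uniq u) (pair_uniq (p1 \oc u)) leftE rightE.
by move=> /cpair_inj [-> qr'] /cpair_inj [pq' r'E]; rewrite r'E in qr' *;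
  rewrite (uniq _ (conj pq' qr')).
Qed.

(** Comparing marginals on [Y] in [tensel p q = m] forces [q] to be that
    marginal of [m] divided by [mass p]; removing one outer factor at a time
    from the hypothesis shows that this [q] solves both equations. *)
Lemma invertible_unique_refinement X Y Z :
  scalars_invertible -> unique_refinement X Y Z.
Proof.
move=> inv W p n m r E.
have [s' s'1] := inv W (mass p).
have [t' t'1] := inv W (mass r).
have s'K A (x : hom W (M A)) : scale (mass p) (scale s' x) = x.
  by rewrite -scaleM s'1 scale1.
(* Project [E] away from [X], then away from [Z], then away from both. *)
have dropX : scale (mass p) n = tensel (Tm p2 \oc m) r.
  rewrite -marginal2 E tensel_natl TmMA.
  by congr (Tm _ \oc _); cext.
have dropZ : tensel p (Tm p1 \oc n) = scale (mass r) m.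
  rewrite -marginal1 tensel_natr E TmMA.
  by congr (Tm _ \oc _); cext.
have dropXZ : scale (mass p) (Tm p1 \oc n) = scale (mass r) (Tm p2 \oc m).
  by rewrite -scale_nat dropX marginal1.
exists (scale s' (Tm p2 \oc m)); split=> [|q [pq _]]; last first.
  by apply: (scale_cancel s'1); rewrite s'K -pq marginal2.
split.
  apply: (scale_cancel t'1).
  by rewrite -tensel_scaler -scaleM (scaleC _ s') scaleM -dropXZ -scaleM
       (scaleC s') s'1 scale1.
by apply: (scale_cancel s'1); rewrite dropX tensel_scalel s'K.
Qed.

(** The decompositions [a * 1] and [1 * a] agree up to the identification of
    [one \x one] with [one], so a refinement of them contains [y] with
    [a * y = 1]. *)
Lemma unique_refinement_invertible :
  unique_refinement one one one -> scalars_invertible.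
Proof.
move=> ref W a.
have mulE (s t : hom W (M one)) :
    tensel s t = Tm (cpair (idm one) (idm one)) \oc scale s t.
  rewrite TmMA -[LHS]comp1m -Tm1.
  by congr (Tm _ \oc _); cext.
have [|y [[ay _] _]] := ref W a (Tm (cpair (idm one) (idm one)) \oc scal1 W)
  (Tm (cpair (idm one) (idm one)) \oc scal1 W) a.
  rewrite tensel_natl tensel_natr !mulE scaleC !TmMA.
  by congr (Tm _ \oc _); cext.
by exists y; rewrite /scale ay TmMA p2_pair Tm1 comp1m.
Qed.

End Scalars.

Theorem theorem4p7 (D : cartesian) (M : commMonad D) :
  (weakly_affine M <-> weakly_markov (kl M)) /\
  (weakly_markov (kl M) <->
     forall X Y Z : D, assoc_square_pullback M X Y Z).
Proof.
have affP := weakly_affineP M; have markP := weakly_markovP M.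
split; first by split=> [/affP /markP | /markP /affP].
split=> [/markP inv X Y Z | pb].
  exact/assoc_square_pullbackP/invertible_unique_refinement.
exact/markP/unique_refinement_invertible/assoc_square_pullbackP.
Qed.
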